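(* Each group $X$ with periodic commutators has trivial twinic ideal. That is, if for all $x,y\in X$ the commutator $xyx^{-1}y^{-1}$ has finite order, then for every subset $A\subset X$ and all $x,y\in X$ with $xA\subset X\setminus A\subset yA$ one has $xA=X\setminus A=yA$.
   Context: A group $X$ has periodic commutators if for any $x,y\in X$ the commutator $[x,y]=xyx^{-1}y^{-1}$ has finite order in $X$. A group $X$ is said to have trivial twinic ideal if the ideal $\{\emptyset\}$ is twinic, i.e. if for any subset $A\subset X$ and $x,y\in X$ with $xA\subset X\setminus A\subset yA$ we get $xA=X\setminus A=yA$. Here $xA=\{xa:a\in A\}$. *)

(* Defs.v *)
From HB Require Import structures.
From mathcomp Require Import all_boot.
From mathcomp Require Import boolp classical_sets.

Set Implicit Arguments.
Unset Strict Implicit.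
Unset Printing Implicit Defensive.

Local Open Scope classical_set_scope.
Local Open Scope group_scope.

Definition has_finite_order (X : groupType) (g : X) : Prop :=
  exists2 n : nat, (0 < n)%N & g ^+ n = 1.

(* The commutator is [x y x^-1 y^-1]; MathComp's [[~ x, y]] is [x^-1 y^-1 x y]. *)
Definition periodic_commutators (X : groupType) : Prop :=
  forall x y : X, has_finite_order (x * y * x^-1 * y^-1).

Definition left_translate (X : groupType) (x : X) (A : set X) : set X :=
  [set x * a | a in A].

(* Twinicity of the ideal {set0}: inclusion and equality modulo this ideal are
   plain inclusion and equality of sets. *)
Definition trivial_twinic_ideal (X : groupType) : Prop :=
  forall (A : set X) (x y : X),
    left_translate x A `<=` ~` A -> ~` A `<=` left_translate y A ->
    left_translate x A = ~` A /\ ~` A = left_translate y A.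

(* Main.v *)
(** If [x A] misses [A] and [y A] covers the complement [~` A], then [~` A] is
    stable under left multiplication by [x y] and [x^-1 y^-1], whose product is
    a commutator; since that product has finite order, [~` A] is also stable
    under [(x y)^-1], which forces [~` A `<=` x A].  Symmetrically, [A] is stable
    under [y^-1 x^-1] and [y x], hence under [x y], which forces
    [y A `<=` ~` A]. *)
Require Import Defs.
From HB Require Import structures.
From mathcomp Require Import all_boot.
From mathcomp Require Import boolp classical_sets.

Local Open Scope classical_set_scope.
Local Open Scope group_scope.

Lemma left_translateP (X : groupType) (x : X) (A : set X) (z : X) :
  left_translate x A z <-> A (x^-1 * z).
Proof.
split=> [[a Aa <-]|Az]; first by rewrite mulKg.
by exists (x^-1 * z) => //; rewrite mulVKg.
Qed.

Lemma stable_expg (X : groupType) (S : set X) (u : X) (n : nat) :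
  (forall s, S s -> S (u * s)) -> forall s, S s -> S (u ^+ n * s).
Proof.
move=> Su; elim: n => [|n IHn] s Ss; first by rewrite expg0 mul1g.
by rewrite expgS -mulgA; apply/Su/IHn.
Qed.

(** When [(u * v) ^+ n.+1 = 1], the inverse [u^-1] equals [v * (u * v) ^+ n], a product of factors
    [u] and [v] alone. *)
Lemma stable_invg (X : groupType) (S : set X) (u v : X) :
  has_finite_order (u * v) ->
  (forall s, S s -> S (u * s)) -> (forall s, S s -> S (v * s)) ->
  forall s, S s -> S (u^-1 * s).
Proof.
move=> [[//|n] _ uvn] Su Sv s Ss.
have -> : u^-1 = v * (u * v) ^+ n.
  by apply: (mulgI u); rewrite mulgV mulgA -expgS uvn.
rewrite -mulgA; apply: (Sv); apply: stable_expg => // t St.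
by rewrite -mulgA; apply: Su; apply: Sv.
Qed.

Theorem proposition6p3 (X : groupType) (hX : periodic_commutators X) :
  trivial_twinic_ideal X.
Proof.
move=> A x y xA_sub sub_yA.
have nAx a : A a -> ~ A (x * a).
  by move=> Aa; apply: xA_sub; apply/left_translateP; rewrite mulKg.
have nAVx a : A a -> ~ A (x^-1 * a).
  by move=> Aa /nAx; rewrite mulVKg.
have AVy b : ~ A b -> A (y^-1 * b).
  by move=> /sub_yA /left_translateP.
have Ay b : ~ A b -> A (y * b).
  by move=> nAb; apply: contrapT => /AVy; rewrite mulKg.
split; apply/seteqP; split=> // z.
(* Were [x^-1 * z] outside [A], [AVy] would put [(x * y)^-1 * z] in [A], against the stability of
   the complement. *)
- move=> nAz; apply/left_translateP; apply: contrapT => /AVy.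
  rewrite mulgA -invgM; apply: (@stable_invg _ (~` A) (x * y) (x^-1 * y^-1)).
  + by rewrite mulgA; apply: hX.
  + by move=> s nAs; rewrite -mulgA; apply/nAx/Ay.
  + by move=> s nAs; rewrite -mulgA; apply/nAVx/AVy.
  + exact: nAz.
- move=> /left_translateP AVyz Az; apply: (nAx z Az).
  (* Writing [x * y] as the inverse of [y^-1 * x^-1] lets [stable_invg] carry [y^-1 * z] to [x * z]
     inside [A]. *)
  have -> : x * z = (y^-1 * x^-1)^-1 * (y^-1 * z).
    by rewrite invgM !invgK -mulgA mulVKg.
  apply: (@stable_invg _ A _ (y * x)) => // [|s As|s As].
  + by have := hX y^-1 x^-1; rewrite !invgK !mulgA.
  + by rewrite -mulgA; apply/AVy/nAVx.
  + by rewrite -mulgA; apply/Ay/nAx.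
Qed.
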